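(* Let $\kappa$ be a cardinal $>2$ such that any $\kappa$-complete filter (on any set) can be extended to a $\kappa$-complete ultrafilter (on the same set). Then for any algebraic system $A$ the following are equivalent: (i) $A$ is $\kappa$-subdirectly irreducible. (ii) For any embedding $f$ of $A$ in the direct product $\prod_{i\in \mathbb{I}} B_i$ of a set of algebraic systems $\{B_i\}_{i\in \mathbb{I}}$ (with $\mathbb{I}$ nonempty), there is a $\kappa$-complete ultrafilter $\mathscr{U}$ on the set $\mathbb{I}$ such that the composition of $f$ with the canonical homomorphism $\prod_{i\in \mathbb{I}} B_i \to \prod_{\mathscr{U}} B_i$ is an embedding.
   Context: An algebraic system is a set with a number of operations on it of, generally, various arities (an algebra in the sense of universal algebra). The signature $\Omega$ is arbitrary but fixed, and all algebraic systems are of signature $\Omega$. An embedding is an injective homomorphism. The trivial congruence on $A$ is the diagonal $\{(a,a) \mid a\in A\}$; every other congruence is nontrivial. For a cardinal $\kappa>2$, a set $\mathscr{S}$ of sets is called $\kappa$-complete if the intersection of any nonempty set of fewer than $\kappa$ elements of $\mathscr{S}$ belongs to $\mathscr{S}$. A $\kappa$-complete filter (ultrafilter) is a filter (ultrafilter) which is $\kappa$-complete as a set of sets. Filters are proper (they do not contain the empty set), and ultrafilters may be principal. An algebraic system $A$ is called $\kappa$-subdirectly irreducible if the set of nontrivial congruences of $A$ (as subsets of $A\times A$) is $\kappa$-complete, i.e. the intersection of any nonempty set of fewer than $\kappa$ nontrivial congruences of $A$ is a nontrivial congruence. For an ultrafilter $\mathscr{U}$ on $\mathbb{I}$, the ultraproduct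 $\prod_{\mathscr{U}} B_i$ is the quotient of the direct product $\prod_{i\in\mathbb{I}} B_i$ by the congruence $\theta_{\mathscr{U}}=\{(a,b) \mid \{i\in\mathbb{I} \mid a(i)=b(i)\}\in\mathscr{U}\}$, and the canonical homomorphism is the quotient map. *)

(* Defs.v *)
From HB Require Import structures.
From mathcomp Require Import all_boot.
From mathcomp Require Import boolp classical_sets functions cardinality filter.

Set Implicit Arguments.
Unset Strict Implicit.
Unset Printing Implicit Defensive.

Local Open Scope classical_set_scope.
Local Open Scope card_scope.
Local Open Scope quotient_scope.

Definition card_lt (T U : Type) (X : set T) (Y : set U) : Prop :=
  (X #<= Y) /\ ~ (Y #<= X).

Notation "X '#<' Y" := (card_lt X Y) (at level 79) : card_scope.

(* A cardinal kappa is represented by a type K of that cardinality: "fewer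
   than kappa" reads [#< [set: K]]. *)
Definition kcomplete (K : Type) (X : Type) (S : set (set X)) : Prop :=
  forall C : set (set X),
    C `<=` S -> C !=set0 -> C #< [set: K] -> S (\bigcap_(Y in C) Y).

Definition filter_extension (K : Type) : Prop :=
  forall (T : Type) (F : set_system T),
    ProperFilter F -> kcomplete K F ->
    exists G : set_system T, [/\ UltraFilter G, kcomplete K G & F `<=` G].

(* Arities are finite, possibly 0; carriers may be empty. *)
Record signature := Signature {
  symbol : Type;
  arity : symbol -> nat }.

Record algebra (Om : signature) := Algebra {
  carrier :> Type;
  oper : forall s : symbol Om, ('I_(arity s) -> carrier) -> carrier }.

Section Algebras.
Variable Om : signature.

Definition is_hom (A B : algebra Om) (f : A -> B) : Prop :=
  forall (s : symbol Om) (v : 'I_(arity s) -> A),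
    f (oper v) = oper (fun k => f (v k)).

Definition is_embedding (A B : algebra Om) (f : A -> B) : Prop :=
  is_hom f /\ injective f.

Record is_congruence (A : algebra Om) (R : set (A * A)) : Prop := IsCongruence {
  cong_refl : forall a, R (a, a);
  cong_sym : forall a b, R (a, b) -> R (b, a);
  cong_trans : forall a b c, R (a, b) -> R (b, c) -> R (a, c);
  cong_oper : forall (s : symbol Om) (v w : 'I_(arity s) -> A),
    (forall k, R (v k, w k)) -> R (oper v, oper w) }.

Definition nontrivial_congruences (A : algebra Om) : set (set (A * A)) :=
  [set R | is_congruence R /\ R <> diagonal].

Definition subdirectly_irreducible (K : Type) (A : algebra Om) : Prop :=
  kcomplete K (@nontrivial_congruences A).

Section Quotient.
Variables (A : algebra Om) (R : set (A * A)) (RC : is_congruence R).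

Definition cong_rel : rel {classic A} := fun a b => `[< R (a, b) >].

Lemma cong_rel_refl : reflexive cong_rel.
Proof. by move=> a; apply/asboolP; exact: cong_refl RC a. Qed.

Lemma cong_rel_sym : symmetric cong_rel.
Proof.
by move=> a b; apply/asboolP/asboolP; exact: (cong_sym RC).
Qed.

Lemma cong_rel_trans : transitive cong_rel.
Proof.
move=> b a c /asboolP ab /asboolP bc; apply/asboolP.
exact: (cong_trans RC) ab bc.
Qed.

Definition cong_equiv : equiv_rel {classic A} :=
  EquivRel cong_rel cong_rel_refl cong_rel_sym cong_rel_trans.

Definition quotient_map (a : A) : {eq_quot cong_equiv} :=
  \pi_{eq_quot cong_equiv} a.

(* The choice of representatives is immaterial, by [quotient_map_hom]. *)
Definition quotient : algebra Om :=
  @Algebra Om {eq_quot cong_equiv}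
    (fun s v => quotient_map (oper (fun k => repr (v k) : A))).

Lemma quotient_mapP (a b : A) : quotient_map a = quotient_map b <-> R (a, b).
Proof.
split=> [/eqmodP/asboolP //|ab].
by apply/eqmodP/asboolP.
Qed.

Lemma quotient_map_hom : @is_hom A quotient quotient_map.
Proof.
move=> s v; apply/quotient_mapP; apply: (cong_oper RC) => k.
by apply/quotient_mapP; rewrite /quotient_map reprK.
Qed.

End Quotient.

Definition direct_product (I : Type) (B : I -> algebra Om) : algebra Om :=
  @Algebra Om (forall i, B i) (fun s v i => oper (fun k => v k i)).

Section Ultraproduct.
Variables (I : Type) (B : I -> algebra Om) (U : set_system I).

Definition theta : set (direct_product B * direct_product B) :=
  [set ab | U [set i | ab.1 i = ab.2 i]].

Lemma theta_congruence (FU : Filter U) : is_congruence theta.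
Proof.
split=> [a|a b|a b c|s v w vw]; rewrite /theta /=.
- by apply: filterS filterT.
- by apply: filterS => i.
- by move=> ab bc; apply: filterS (filterI ab bc) => i /= [-> ->].
- have : U [set i | forall k, v k i = w k i] by apply: filter_forall vw.
  apply: filterS => i vwi; congr oper; apply/funext => k; exact: vwi.
Qed.

Definition ultraproduct (UU : UltraFilter U) : algebra Om :=
  quotient (theta_congruence _).

Definition ultraproduct_map (UU : UltraFilter U) :
  direct_product B -> ultraproduct UU :=
  quotient_map (theta_congruence _).

End Ultraproduct.

End Algebras.

Arguments ultraproduct {Om I} B {U} UU.
Arguments ultraproduct_map {Om I} B {U} UU.

(* Main.v *)
Require Import Defs.
From mathcomp Require Import all_boot.
From mathcomp Require Import boolp classical_sets functions cardinality filter.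
Local Open Scope classical_set_scope.
Local Open Scope card_scope.

(** Write [kappa] for the cardinal of [K].  A map [f] of [A] into a product
    attaches to every set [J] of indices the congruence [agree_on f J] of the
    pairs which [f] does not separate on [J].  This turns unions of index sets
    into intersections of congruences, and it turns the irreducibility of [A]
    into completeness of a filter of index sets.

    Suppose that [A] is [kappa]-subdirectly irreducible with at least two
    elements, and that [f] is an embedding.  The sets [X] such that the
    coordinates outside [X] do not suffice to separate the points of [A] form
    a [kappa]-complete filter ([nonseparating_filter],
    [nonseparating_kcomplete]); it is proper because [f] is injective.  Let [U]
    be a [kappa]-complete ultrafilter extending it.  If [a <> b] had images
    that agree on a member [X] of [U], then the coordinates in [X] would not
    separate the points of [A], so the complement of [X] would belong to the
    filter, hence to [U], which is absurd
    ([nonseparating_ultraproduct_embedding]).  Hence [A] embeds in the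
    ultraproduct.  When [A] has at most one element, any principal ultrafilter
    will do.

    Conversely, suppose that fewer than [kappa] nontrivial congruences [R]
    intersect in the diagonal.  Then [A] embeds in the product of the quotients
    [A / R], and an ultrafilter [U] on the set of these congruences provides an
    embedding in an ultraproduct.  Since each factor [A / R] identifies two
    distinct points of [A], no singleton [{R}] is in [U]; so all complements of
    singletons are ([quotients_ultrafilter_setC1]), and so is their
    intersection, by completeness.  This intersection is empty, a
    contradiction. *)

(** * Families of fewer than kappa sets *)

Lemma card_le_lt_trans {T V W : Type} (X : set T) (Y : set V) (Z : set W) :
  X #<= Y -> Y #< Z -> X #< Z.
Proof.
move=> XY [YZ nZY]; split; first exact: card_le_trans XY YZ.
by move=> ZX; apply: nZY; exact: card_le_trans ZX XY.
Qed.

(** The form in which completeness is used: images of small families are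
    small, so a complete set contains the intersections of families indexed by
    a small set of any type. *)
Lemma kcomplete_bigcap {K X J : Type} {S : set (set X)} (C : set J)
    (Y : J -> set X) :
  kcomplete K S -> C #< [set: K] -> C !=set0 ->
  (forall j, C j -> S (Y j)) -> S (\bigcap_(j in C) Y j).
Proof.
move=> KS CK [j Cj] SY; rewrite -(bigcap_image C Y id); apply: KS.
- by move=> _ [i Ci <-]; exact: SY.
- by exists (Y j), j.
- exact: card_le_lt_trans (card_image_le Y C) CK.
Qed.

Lemma kcomplete_setI {K X : Type} {S : set (set X)} :
  [set: bool] #< [set: K] -> kcomplete K S -> setI_closed S.
Proof.
move=> K_gt2 KS P Q SP SQ.
have -> : P `&` Q = \bigcap_(b in [set: bool]) (if b then P else Q).
  apply/seteqP; split=> [x [Px Qx] [] _ //|x PQx].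
  by split; [exact: (PQx true)|exact: (PQx false)].
by apply: (kcomplete_bigcap _ _ KS K_gt2) => [|[] _ //]; exists true.
Qed.

Lemma principal_filter_kcomplete {K I : Type} (i : I) :
  kcomplete K (principal_filter i).
Proof.
move=> C Ci _ _; apply/principal_filterP => Y CY.
by apply/principal_filterP; exact: Ci.
Qed.

(** * Congruences and maps into ultraproducts *)

Lemma nontrivial_congruenceP {Om : signature} {A : algebra Om}
    {R : set (A * A)} :
  is_congruence R ->
  nontrivial_congruences R <-> exists a b, R (a, b) /\ a <> b.
Proof.
move=> RC; split=> [[_ RD]|[a [b [Rab ab]]]].
  apply: contrapT => triv; apply: RD; apply/seteqP; split=> [[a b] Rab|].
    by apply: contrapT => ab; apply: triv; exists a, b.
  by move=> [a b]; rewrite /diagonal /= => ->; exact: (cong_refl RC).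
by split=> // RD; apply: ab; rewrite RD in Rab.
Qed.

Lemma bigcap_congruence {Om : signature} {A : algebra Om}
    (C : set (set (A * A))) :
  C `<=` [set R | is_congruence R] -> is_congruence (\bigcap_(R in C) R).
Proof.
move=> CC; split=> [a R CR|a b ab R CR|a b c ab bc R CR|s v w vw R CR].
- exact: cong_refl (CC _ CR) a.
- by apply: (cong_sym (CC _ CR)); exact: ab.
- by apply: (cong_trans (CC _ CR)); [exact: ab|exact: bc].
- by apply: (cong_oper (CC _ CR)) => k; exact: vw.
Qed.

Lemma ultraproduct_mapP {Om : signature} {I : Type} {B : I -> algebra Om}
    {U : set_system I} (UU : UltraFilter U) (x y : direct_product B) :
  ultraproduct_map B UU x = ultraproduct_map B UU y <->
  U [set i | x i = y i].
Proof. exact: quotient_mapP. Qed.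

Lemma ultraproduct_map_comp_hom {Om : signature} {A : algebra Om} {I : Type}
    {B : I -> algebra Om} {U : set_system I} (UU : UltraFilter U)
    (f : A -> direct_product B) :
  is_hom f -> is_hom (ultraproduct_map B UU \o f).
Proof.
have pM : is_hom (ultraproduct_map B UU) by exact: quotient_map_hom.
by move=> fM s v; rewrite /= fM pM.
Qed.

(** * The filter of a map into a product *)

Section ProductMap.
Context {Om : signature} {A : algebra Om} {I : Type} {B : I -> algebra Om}.
Variable f : A -> direct_product B.

Definition agree_on (J : set I) : set (A * A) :=
  [set ab | forall i, J i -> f ab.1 i = f ab.2 i].

(** The filter dual to the ideal of the index sets whose coordinates fail to
    separate the points of [A]. *)
Definition nonseparating : set_system I :=
  [set X | nontrivial_congruences (agree_on (~` X))].

Lemma agree_on_congruence (J : set I) :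
  is_hom f -> is_congruence (agree_on J).
Proof.
move=> fM; split=> [a i|a b ab i Ji|a b c ab bc i Ji|s v w vw i Ji] //=.
- by rewrite -(ab i Ji).
- by rewrite (ab i Ji); exact: bc.
- rewrite !fM /=; congr oper; apply/funext => k; exact: vw.
Qed.

Lemma agree_on_setC_bigcap (C : set (set I)) :
  agree_on (~` \bigcap_(X in C) X) = \bigcap_(X in C) agree_on (~` X).
Proof.
apply/seteqP; split=> [ab abC X CX i nXi|ab abC i nCi].
  by apply: abC => Ci; apply: nXi; exact: Ci.
apply: contrapT => nab; apply: nCi => X CX.
by apply: contrapT => nXi; apply: nab; exact: abC CX i nXi.
Qed.

Lemma nonseparating_kcomplete {K : Type} :
  subdirectly_irreducible K A -> kcomplete K nonseparating.
Proof.
move=> irr C CF C0 CK; rewrite /nonseparating /= agree_on_setC_bigcap.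
exact: kcomplete_bigcap irr CK C0 CF.
Qed.

(** Properness expresses that [f] is injective; the whole index set is a
    member because [A] has two distinct points. *)
Lemma nonseparating_filter {K : Type} :
  [set: bool] #< [set: K] -> subdirectly_irreducible K A ->
  is_embedding f -> (exists a b : A, a <> b) -> ProperFilter nonseparating.
Proof.
move=> K_gt2 irr [fM finj] [a [b ab]]; split.
  move=> /(nontrivial_congruenceP (agree_on_congruence _ fM)) [x [y [xy]]].
  by apply; apply: finj; apply: functional_extensionality_dep => i; exact: xy.
split.
- apply/(nontrivial_congruenceP (agree_on_congruence _ fM)).
  by exists a, b; split=> // i; rewrite setCT.
- exact: kcomplete_setI K_gt2 (nonseparating_kcomplete irr).
- move=> P Q PQ /(nontrivial_congruenceP (agree_on_congruence _ fM)).
  move=> [x [y [xy nxy]]].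
  apply/(nontrivial_congruenceP (agree_on_congruence _ fM)).
  by exists x, y; split=> // i nQi; apply: xy => /PQ.
Qed.

(** If the images of distinct points agreed on a member [X] of [U], then
    [~` X] would be in [nonseparating f], and [U] would contain both [X] and
    [~` X]. *)
Lemma nonseparating_ultraproduct_embedding {U : set_system I}
    (UU : UltraFilter U) :
  is_embedding f -> nonseparating `<=` U ->
  is_embedding (ultraproduct_map B UU \o f).
Proof.
move=> [fM _] FU; split; first exact: ultraproduct_map_comp_hom.
move=> a b /ultraproduct_mapP; set X := [set i | _] => UX.
apply: contrapT => ab; apply: (@filter_not_empty _ U).
rewrite -(setICr X); apply: filterI => //; apply: FU.
apply/(nontrivial_congruenceP (agree_on_congruence _ fM)).
by exists a, b; split=> // i; rewrite setCK.
Qed.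

End ProductMap.

Lemma subdirectly_irreducible_ultraproduct (K : Type)
    (K_gt2 : [set: bool] #< [set: K]) (K_ext : filter_extension K)
    (Om : signature) (A : algebra Om) (I : Type) (B : I -> algebra Om)
    (f : A -> direct_product B) :
  subdirectly_irreducible K A -> inhabited I -> is_embedding f ->
  exists (U : set_system I) (UU : UltraFilter U),
    kcomplete K U /\ is_embedding (ultraproduct_map B UU \o f).
Proof.
move=> irr [i0] fE; have [A2|A1] := pselect (exists a b : A, a <> b).
  have FF := nonseparating_filter f K_gt2 irr fE A2.
  have [U [UU KU FU]] := K_ext I _ FF (nonseparating_kcomplete f irr).
  exists U, UU; split=> //; exact: nonseparating_ultraproduct_embedding.
exists (principal_filter i0), (principal_filter_ultra i0).
split; first exact: principal_filter_kcomplete.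
split; first by apply: ultraproduct_map_comp_hom; case: fE.
by move=> a b _; apply: contrapT => ab; apply: A1; exists a, b.
Qed.

(** * The product of the quotients by a family of congruences *)

Section QuotientProduct.
Context {Om : signature} {A : algebra Om} {C : set (set (A * A))}.
Variable CC : C `<=` [set R | is_congruence R].

Definition quotients (R : {R | C R}) : algebra Om :=
  quotient (CC _ (proj2_sig R)).

Definition quotients_map (a : A) : direct_product quotients :=
  fun R => quotient_map (CC _ (proj2_sig R)) a.

Lemma quotients_mapP (R : {R | C R}) (a b : A) :
  quotients_map a R = quotients_map b R <-> proj1_sig R (a, b).
Proof. exact: quotient_mapP. Qed.

Lemma quotients_map_embedding :
  \bigcap_(R in C) R = diagonal -> is_embedding quotients_map.
Proof.
move=> CD; split=> [s v|a b fab].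
  by apply: functional_extensionality_dep => R; exact: quotient_map_hom.
suff : (\bigcap_(R in C) R) (a, b) by rewrite CD.
by move=> R CR; apply/(quotients_mapP (exist _ R CR)); rewrite fab.
Qed.

(** An ultrafilter containing the singleton of [R] makes the ultraproduct
    identify whatever the factor at [R] identifies. *)
Lemma quotients_ultrafilter_setC1 {U : set_system {R | C R}}
    (UU : UltraFilter U) (R : set (A * A)) :
  injective (ultraproduct_map quotients UU \o quotients_map) ->
  nontrivial_congruences R -> U [set S | proj1_sig S <> R].
Proof.
move=> finj Rnt.
have [RC _] := Rnt; have [a [b [Rab ab]]] := (nontrivial_congruenceP RC).1 Rnt.
have [UR|//] := in_ultra_setVsetC [set S : {R | C R} | proj1_sig S = R] UU.
case: ab; apply: finj; apply/ultraproduct_mapP.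
by apply: filterS UR => S /= SR; apply/quotients_mapP; rewrite SR.
Qed.

End QuotientProduct.

Lemma subdirectly_irreducible_of_ultraproduct (K : Type) (Om : signature)
    (A : algebra Om) :
  (forall (I : Type) (B : I -> algebra Om) (f : A -> direct_product B),
     inhabited I -> is_embedding f ->
     exists (U : set_system I) (UU : UltraFilter U),
       kcomplete K U /\ is_embedding (ultraproduct_map B UU \o f)) ->
  subdirectly_irreducible K A.
Proof.
move=> ultra C Cnt C0 CK.
have CC : C `<=` [set R | is_congruence R] by move=> R /Cnt [].
split; first exact: bigcap_congruence.
move=> /(quotients_map_embedding CC) fE.
have I0 : inhabited {R | C R} by case: C0 => R CR; exists; exists R.
have [U [UU [KU [_ finj]]]] := ultra _ _ _ I0 fE.
apply: (@filter_not_empty _ U).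
have : U (\bigcap_(R in C) [set S | proj1_sig S <> R]).
  apply: kcomplete_bigcap KU CK C0 _ => R /Cnt.
  exact: quotients_ultrafilter_setC1 finj.
by apply: filterS => -[R CR] /(_ R CR).
Qed.

Theorem theorem1 (K : Type) (K_gt2 : [set: bool] #< [set: K])
    (K_ext : filter_extension K) (Om : signature) (A : algebra Om) :
  subdirectly_irreducible K A <->
  (forall (I : Type) (B : I -> algebra Om) (f : A -> direct_product B),
     inhabited I -> is_embedding f ->
     exists (U : set_system I) (UU : UltraFilter U),
       kcomplete K U /\ is_embedding (ultraproduct_map B UU \o f)).
Proof.
split; last exact: subdirectly_irreducible_of_ultraproduct.
by move=> irr I B f; exact: subdirectly_irreducible_ultraproduct.
Qed.
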